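(* Let $Q(x)=\sum_{k\geq0}op_{[2^k]}(123)x^{2k}$. Then \begin{align*} &\left(\tfrac{21}{2}x^7+\tfrac{329}{8}x^5-\tfrac{7}{2}x^3\right)Q'''(x)+\left(99x^6+\tfrac{1443}{8}x^4-5x^2\right)Q''(x)\\ &\qquad+\left(207x^5+\tfrac{717}{8}x^3+11x\right)Q'(x)+(72x^4-12x^2)Q(x)=0. \end{align*}
   Context: An ordered partition of $[n]=\{1,\dots,n\}$ is a sequence $B_1/\cdots/B_k$ of nonempty pairwise disjoint subsets of $[n]$ with union $[n]$. It contains the pattern $123$ if there are indices $i_1<i_2<i_3$ and elements $b_j\in B_{i_j}$ with $b_1<b_2<b_3$; otherwise it avoids $123$. $op_{[2^k]}(123)$ is the number of $123$-avoiding ordered partitions of $[2k]$ with $k$ blocks each of size $2$ (with $op_{[2^0]}(123)=1$). *)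

(* Defs.v *)
From mathcomp Require Import all_boot all_order all_algebra.

Set Implicit Arguments.
Unset Strict Implicit.
Unset Printing Implicit Defensive.

Import GRing.Theory.
Local Open Scope ring_scope.

(* The ground set [n] = {1, ..., n} is represented by 'I_n = {0, ..., n - 1}
   with its natural order. *)
Definition ordered_partition (n k : nat) (B : k.-tuple {set 'I_n}) : bool :=
  [&& [forall i : 'I_k, tnth B i != set0],
      [forall i : 'I_k, forall j : 'I_k,
         (i != j) ==> [disjoint tnth B i & tnth B j]]
    & \bigcup_(i < k) tnth B i == [set: 'I_n]].

Definition contains123 (n k : nat) (B : k.-tuple {set 'I_n}) : bool :=
  [exists i1 : 'I_k, exists i2 : 'I_k, exists i3 : 'I_k,
    (i1 < i2 < i3)%N &&
    [exists b1 in tnth B i1, exists b2 in tnth B i2, exists b3 in tnth B i3,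
      (b1 < b2 < b3)%N]].

Definition op2_123 (k : nat) : nat :=
  #|[set B : k.-tuple {set 'I_(2 * k)} |
      [&& ordered_partition B,
          [forall i : 'I_k, #|tnth B i| == 2%N]
        & ~~ contains123 B]]|.

(* A formal power series is its coefficient sequence: s n is the coefficient
   of x^n.  Equality of series is pointwise equality =1. *)
Definition fps (R : nzRingType) : Type := nat -> R.

Section FormalPowerSeries.
Variable R : nzRingType.
Implicit Types s t : fps R.

Definition fps0 : fps R := fun _ => 0.
Definition fps_add s t : fps R := fun n => s n + t n.
Definition fps_mul s t : fps R := fun n => \sum_(i < n.+1) s i * t (n - i)%N.
Definition fps_deriv s : fps R := fun n => s n.+1 *+ n.+1.
Definition fps_poly (p : {poly R}) : fps R := fun n => p`_n.

End FormalPowerSeries.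

Arguments fps0 {R} _.

Declare Scope fps_scope.
Delimit Scope fps_scope with fps.
Bind Scope fps_scope with fps.
Notation "s + t" := (fps_add s t) : fps_scope.
Notation "s * t" := (fps_mul s t) : fps_scope.
Notation "p %:S" := (fps_poly p%R)
  (at level 2, left associativity, format "p %:S") : fps_scope.
Notation "s ^`( m )" := (iter m (@fps_deriv _) s) : fps_scope.

(* Q(x) = \sum_(k >= 0) op2_123 k x^(2k) *)
Definition Q : fps rat :=
  fun n => if odd n then 0 else (op2_123 n./2)%:R.

(* Main.v *)
(** Reading the block index of each element turns the partitions into words in
    which every letter below [k] occurs twice and which avoid 123.  Such a word
    arises from a unique smaller one by inserting two copies of the new largest
    letter into its maximal weakly decreasing prefix.  If that prefix has length
    [s], the prefix lengths of the new words are [s + 2], [i + 1] for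
    [1 <= i <= s], and [j] for [1 <= j <= i <= s].  With [F(z, u)] counting words
    by number of letters and prefix length, and [u = 1 + v], the kernel of the
    resulting functional equation is [z (1 + v)^2 (1 + v + v^2) = v^2].  It is
    palindromic in [v], and in terms of the product [- q] of its two small roots
      [z = q (1 - q)^2 / (1 + q + q^2)^2],
      [F(z, 1) = (1 + q + q^2) / (1 - q^2)],
      [F(z, 1 + v) = F(z, 1) (1 - q v) / (1 - 3 q v / (1 - q) - q v^2)].
    The coefficients of [v^m] are the binomial moments of the prefix length, and
    the last formula is verified through their recurrence.  The differential
    equation becomes an identity between rational functions of [q]. *)

Require Import Defs.
From HB Require Import structures.
From mathcomp Require Import all_boot all_order all_algebra.
From mathcomp Require Import boolp.
From mathcomp Require Import ring zify.

Set Implicit Arguments.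
Unset Strict Implicit.
Unset Printing Implicit Defensive.

Import GRing.Theory.

(** * Words *)

Fixpoint avoids123 (w : seq nat) : bool :=
  if w is x :: w' then
    pairwise (fun a b => ~~ (x < a < b)) w' && avoids123 w'
  else true.

Fixpoint descent_prefix (w : seq nat) : nat :=
  if w is x :: w' then
    if w' is y :: _ then if y <= x then (descent_prefix w').+1 else 1 else 1
  else 0.

(** Both [i] and [j] count letters of the original [w], so the pair [(i, j)] names two gaps of [w].
    The earlier gap is [j], and [i = j] puts the two copies side by side. *)
Definition insert2 (m : nat) (w : seq nat) (i j : nat) : seq nat :=
  take j w ++ m :: take (i - j) (drop j w) ++ m :: drop i w.

Definition sites (s : nat) : seq (nat * nat) :=
  [seq (i, j) | i <- iota 0 s.+1, j <- iota 0 i.+1].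

Fixpoint words (k : nat) : seq (seq nat) :=
  if k is k'.+1 then
    [seq insert2 k' w ij.1 ij.2 | w <- words k', ij <- sites (descent_prefix w)]
  else [:: [::]].

Lemma wordsS (k : nat) :
  words k.+1 =
  [seq insert2 k w ij.1 ij.2 | w <- words k, ij <- sites (descent_prefix w)].
Proof. by []. Qed.

Definition double_word (k : nat) (w : seq nat) : Prop :=
  [/\ size w = 2 * k, all (gtn k) w,
      forall c, c < k -> count_mem c w = 2 & avoids123 w].

Lemma avoids123P (w : seq nat) :
  reflect (forall x y z, x < y -> y < z -> z < size w ->
             ~~ (nth 0 w x < nth 0 w y < nth 0 w z))
          (avoids123 w).
Proof.
elim: w => [|a w IH] /=; first by apply: ReflectT => x y z _ _; rewrite ltn0.
apply: (iffP andP) => [[/(pairwiseP 0) pw /IH av] [|x] [|y] [|z] //= xy yz zw|H].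
- by apply: pw => //; rewrite inE; lia.
- exact: av.
split.
  apply/(pairwiseP 0) => i j; rewrite !inE => ii jj ij.
  exact: (H 0 i.+1 j.+1).
by apply/IH => x y z xy yz zw; apply: (H x.+1 y.+1 z.+1).
Qed.

Lemma geq_trans : transitive geq.
Proof. by move=> y x z /= xy yz; apply: leq_trans yz xy. Qed.

(** No letter exceeds [m], so the inserted [m] can only play the role of 3, and it does so exactly
    when [p] contains a strict ascent. Equality with [m] is allowed in [r] because the other copy
    may already be there. *)
Lemma avoids123_insert (m : nat) (p r : seq nat) :
  all (gtn m) p -> all (geq m) r ->
  avoids123 (p ++ m :: r) = avoids123 (p ++ r) && sorted geq p.
Proof.
move=> + rm; elim: p => [_|x p IH] /=.
  rewrite andbT; suff -> : pairwise (fun a b => ~~ (m < a < b)) r by [].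
  elim: r rm => [//|y r IHr] /= /andP[ym rm]; rewrite IHr // andbT.
  by apply/allP => z _; lia.
move=> /andP[xm pm]; rewrite IH // (path_sortedE geq_trans).
rewrite !pairwise_cat allrel_consr /=.
have -> : all (fun a => ~~ (x < a < m)) p = all (geq x) p.
  by apply: eq_in_all => a /(allP pm) /=; lia.
have -> : all (fun b => ~~ (x < m < b)) r.
  by apply/allP => b /(allP rm) /=; lia.
rewrite /=; case: (all (geq x) p); rewrite ?andbF ?andbT //=.
by rewrite -!andbA.
Qed.

Lemma descent_prefix_size (w : seq nat) : descent_prefix w <= size w.
Proof. by elim: w => [//|x [|y w] IH] //=; case: ifP. Qed.

Lemma sorted_take_descent (w : seq nat) (i : nat) :
  i <= size w -> sorted geq (take i w) = (i <= descent_prefix w).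
Proof.
elim: w i => [|x w IH] [|i] //= iw.
case: w IH iw => [|y w] IH iw; first by case: i iw.
case: i iw => [|i] iw; first by case: ifP.
have := IH i.+1 iw; rewrite /= => ->.
by case: (leqP y x).
Qed.

(** The inserted [m] is larger than the last letter of [p], so the first ascent of the word is at
    that place. *)
Lemma descent_prefix_insert (m : nat) (p r : seq nat) :
  0 < size p -> all (gtn m) p -> sorted geq p ->
  descent_prefix (p ++ m :: r) = size p.
Proof.
elim: p => [//|x [|y p] IH] _ /=; first by rewrite andbT ltnNge => /negPf->.
move=> /andP[xm pm] /andP[yx ps]; rewrite yx; congr _.+1.
by apply: IH.
Qed.

Lemma descent_prefix_cons (m : nat) (w : seq nat) :
  all (geq m) w -> descent_prefix (m :: w) = (descent_prefix w).+1.
Proof. by case: w => [//|y w] /= /andP[->]. Qed.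

Lemma mem_sites (s i j : nat) : ((i, j) \in sites s) = (j <= i <= s).
Proof.
apply/allpairsPdep/idP => [[i' [j' [+ + [-> ->]]]]|/andP[ji is_]].
  by rewrite !mem_iota; lia.
by exists i, j; rewrite !mem_iota; split=> //; lia.
Qed.

Lemma insert2_decomp (m : nat) (w : seq nat) (i j : nat) : j <= i -> i <= size w ->
  exists p1 p2 p3, [/\ w = p1 ++ p2 ++ p3, size p1 = j, size p2 = i - j
                     & insert2 m w i j = p1 ++ m :: p2 ++ m :: p3].
Proof.
move=> ji iw; exists (take j w), (take (i - j) (drop j w)), (drop i w); split=> //.
- have -> : drop i w = drop (i - j) (drop j w) by rewrite drop_drop subnK.
  by rewrite !cat_take_drop.
- by rewrite size_takel //; lia.
- by rewrite size_takel // size_drop; lia.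
Qed.

Lemma insert2_cat (m : nat) (p1 p2 p3 : seq nat) :
  insert2 m (p1 ++ p2 ++ p3) (size p1 + size p2) (size p1) =
  p1 ++ m :: p2 ++ m :: p3.
Proof.
rewrite /insert2 take_size_cat // drop_size_cat // addKn take_size_cat //.
by rewrite catA drop_size_cat // size_cat.
Qed.

(** Applied to each copy of [k], [avoids123_insert] asks that [p1] and [p1 ++ p2] be weakly
    decreasing. The second condition implies the first, and it says that the later gap lies within
    the decreasing prefix. *)
Lemma double_word_insert2 (k : nat) (p1 p2 p3 : seq nat) :
  k \notin p1 ++ p2 ++ p3 ->
  double_word k.+1 (p1 ++ k :: p2 ++ k :: p3) <->
  double_word k (p1 ++ p2 ++ p3) /\
  size p1 + size p2 <= descent_prefix (p1 ++ p2 ++ p3).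
Proof.
move=> kp; rewrite /double_word.
have szE : size (p1 ++ k :: p2 ++ k :: p3) = (size (p1 ++ p2 ++ p3)).+2.
  by rewrite !size_cat /= size_cat /=; lia.
have lek : all (gtn k.+1) (p1 ++ k :: p2 ++ k :: p3) = all (gtn k) (p1 ++ p2 ++ p3).
  have -> : all (gtn k) (p1 ++ p2 ++ p3) = all (gtn k.+1) (p1 ++ p2 ++ p3).
    by apply: eq_in_all => a aw /=; have := memPn kp _ aw; lia.
  by rewrite !all_cat /= all_cat /= !ltnSn.
rewrite lek.
have cnt c : count_mem c (p1 ++ k :: p2 ++ k :: p3) =
             count_mem c (p1 ++ p2 ++ p3) + 2 * (k == c).
  by rewrite !count_cat /= !count_cat /=; lia.
have av : all (gtn k) (p1 ++ p2 ++ p3) ->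
  avoids123 (p1 ++ k :: p2 ++ k :: p3) =
  avoids123 (p1 ++ p2 ++ p3) && (size p1 + size p2 <= descent_prefix (p1 ++ p2 ++ p3)).
  move=> lt; have := lt; rewrite !all_cat => /and3P[l1 l2 l3].
  have w3 p : all (gtn k) p -> all (geq k) p by apply: sub_all => a; apply: ltnW.
  rewrite avoids123_insert //; last by rewrite all_cat /= leqnn !w3.
  rewrite catA avoids123_insert ?all_cat ?l1 ?l2 ?w3 //.
  rewrite -catA -sorted_take_descent; last by rewrite !size_cat; lia.
  rewrite catA take_size_cat ?size_cat // -andbA.
  case: (boolP (sorted geq (p1 ++ p2))) => //= /cat_sorted2[-> _] //.
split.
- move=> [sz lt ct]; rewrite av // => /andP[-> ->]; split=> //; split=> // [|c ck].
  by lia.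
  by have := ct c (ltnW ck); rewrite cnt; lia.
- move=> [[sz lt ct a]] d; rewrite av // a d; split=> // [|c]; first by lia.
  rewrite ltnS cnt.
  rewrite leq_eqVlt => /predU1P[->|ck]; last by rewrite ct //; lia.
  by rewrite (count_memPn kp) eqxx.
Qed.

Lemma split2 (k : nat) (w : seq nat) : count_mem k w = 2 ->
  exists p1 p2 p3, w = p1 ++ k :: p2 ++ k :: p3 /\ k \notin p1 ++ p2 ++ p3.
Proof.
have split1 (v : seq nat) : 0 < count_mem k v ->
    exists p r, v = p ++ k :: r /\ count_mem k p = 0.
  rewrite -has_count => /split_find[x p r /eqP-> kp].
  by exists p, r; rewrite cat_rcons; split=> //; apply/eqP; rewrite eqn0Ngt -has_count.
move=> c2; have [|p1 [r [wE c1]]] := split1 w; first by rewrite c2.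
have [|p2 [p3 [rE c3]]] := split1 r.
  by move: c2; rewrite wE count_cat /= eqxx c1; lia.
exists p1, p2, p3; rewrite wE rE; split=> //; apply/count_memPn.
by move: c2; rewrite wE rE !count_cat /= !count_cat /= eqxx; lia.
Qed.

(** Deleting the two copies of the largest letter inverts the insertion, and [double_word_insert2]
    identifies the admissible pairs of gaps with [sites]. *)
Lemma mem_words (k : nat) (w : seq nat) : w \in words k <-> double_word k w.
Proof.
elim: k w => [|k IH] w.
  rewrite /= inE; split=> [/eqP->|[/size0nil->]] //.
split.
  case/allpairsPdep => v [[i j] [/IH vk + ->]] /=; rewrite mem_sites => /andP[ji iv].
  have iw := leq_trans iv (descent_prefix_size v).
  have [p1 [p2 [p3 [vE s1 s2 ->]]]] := insert2_decomp k ji iw.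
  apply/double_word_insert2; rewrite -vE; last by rewrite s1 s2 subnKC.
  by case: vk => _ /allP lt _ _; apply/negP => /lt /=; rewrite ltnn.
move=> wk; have [_ _ /(_ k (ltnSn k)) c2 _] := wk.
have [p1 [p2 [p3 [wE kp]]]] := split2 c2.
move: wk; rewrite wE => /(double_word_insert2 kp)[vk d].
apply/allpairsPdep; exists (p1 ++ p2 ++ p3), (size p1 + size p2, size p1).
by rewrite mem_sites leq_addr d insert2_cat; split=> //; apply/IH.
Qed.

Lemma index_cat_cons (m : nat) (p r : seq nat) :
  m \notin p -> index m (p ++ m :: r) = size p.
Proof. by move=> mp; rewrite index_cat (negPf mp) /= eqxx addn0. Qed.

Lemma sites_uniq (s : nat) : uniq (sites s).
Proof.
apply: allpairs_uniq_dep; rewrite ?iota_uniq //.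
  by move=> i _; apply: iota_uniq.
by move=> [i j] [i' j'] _ _ /= [-> ->].
Qed.

(** An insertion can be undone. Filtering out [k] recovers the smaller word, the index of the first
    [k] is [j], and the distance to the second [k] gives [i - j]. *)
Lemma words_uniq (k : nat) : uniq (words k).
Proof.
elim: k => [//|k IH]; rewrite wordsS; apply: allpairs_uniq_dep => //.
  by move=> w _; apply: sites_uniq.
move=> x y /allpairsPdep[w [[i j] [/mem_words wk ij ->]]].
move=> /allpairsPdep[w' [[i' j'] [/mem_words wk' ij' ->]]] /=.
move: ij ij'; rewrite !mem_sites => /andP[ji iw] /andP[ji' iw'].
have {}iw := leq_trans iw (descent_prefix_size w).
have {}iw' := leq_trans iw' (descent_prefix_size w').
have nk v : double_word k v -> k \notin v.
  by case=> _ /allP lt _ _; apply/negP => /lt /=; rewrite ltnn.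
have fk v : k \notin v -> filter (predC1 k) v = v.
  by move=> kv; apply/all_filterP/allP => a av /=; apply: contraNneq kv => <-.
move: (nk _ wk) (nk _ wk').
have [p1 [p2 [p3 [-> s1 s2 ->]]]] := insert2_decomp k ji iw.
have [p1' [p2' [p3' [-> s1' s2' ->]]]] := insert2_decomp k ji' iw'.
move=> kp kp' E.
have := congr1 (filter (predC1 k)) E.
rewrite !filter_cat /= !filter_cat /= eqxx /= -!filter_cat !fk // => ->.
move: kp kp'; rewrite !mem_cat !negb_or => /and3P[k1 k2 k3] /and3P[k1' k2' k3'].
have := congr1 (index k) E; rewrite !index_cat_cons // s1 s1' => jj.
have := congr1 (index k) (congr1 (drop j.+1) E).
rewrite -!cat_rcons !drop_size_cat ?size_rcons ?s1 ?s1' ?jj //.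
by rewrite !cat_rcons !index_cat_cons // s2 s2' => ij; have -> : i = i' by lia.
Qed.

(** * Binomial moments of the prefix length *)

Definition moment (k m : nat) : nat := \sum_(w <- words k) 'C(descent_prefix w, m).

(** The site [(0, 0)] puts both copies in front and lengthens the prefix by two. At [(i + 1, 0)] one
    copy leads and the other ends the prefix after [i + 2] letters. At [(i + 1, j + 1)] the earlier
    copy already ends it after [j + 1] letters. *)
Lemma sum_words (k : nat) (f : nat -> nat) :
  \sum_(w <- words k.+1) f (descent_prefix w) =
  \sum_(w <- words k) (f (descent_prefix w).+2
     + \sum_(i < descent_prefix w) (f i.+2 + \sum_(j < i.+1) f j.+1)).
Proof.
rewrite wordsS big_allpairs_dep /= big_seq [RHS]big_seq.
apply: eq_bigr => w /mem_words wk.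
have iota1 n : iota 1 n = index_iota 1 n.+1 by rewrite /index_iota subSS subn0.
rewrite big_allpairs_dep /= big_cons.
case: (wk) => _ lt _ _.
have le : all (geq k) w by apply: sub_all lt => a; apply: ltnW.
congr (_ + _).
  rewrite big_seq1 /insert2 subnn !take0 !drop0 !cat0s.
  by rewrite !descent_prefix_cons //= leqnn.
rewrite iota1 big_add1 succnK big_mkord; apply: eq_bigr => i _.
rewrite big_cons iota1 big_add1 succnK big_mkord.
have idw := ltn_ord i; have iw := leq_trans idw (descent_prefix_size w).
have st : sorted geq (take i.+1 w) by rewrite sorted_take_descent.
have lt' n : all (gtn k) (take n w).
  by apply/allP => x /mem_take /(allP lt).
congr (f _ + _).
  rewrite /insert2 take0 drop0 subn0 cat0s descent_prefix_cons.
    by rewrite descent_prefix_insert ?size_takel //.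
  rewrite all_cat /= leqnn /=; apply/andP; split.
    by apply/allP => x /mem_take /(allP le).
  by apply/allP => x /mem_drop /(allP le).
apply: eq_bigr => j _; congr f; have ji := ltn_ord j.
rewrite /insert2 descent_prefix_insert ?size_takel //; try lia.
have -> : take j.+1 w = take j.+1 (take i.+1 w) by rewrite take_takel.
exact: take_sorted.
Qed.

Lemma bin_hockey (s m : nat) : \sum_(i < s) 'C(i, m) = 'C(s, m.+1).
Proof. by elim: s => [|s IH]; rewrite ?big_ord0 // big_ord_recr /= IH binS. Qed.

(** Two applications of the hockey-stick identity. The correction on the left supplies the initial
    terms that the shifted sums omit; they are nonzero only for [m = 0] and [m = 1]. *)
Lemma sum_children (s m : nat) :
  'C(s.+2, m) + \sum_(i < s) ('C(i.+2, m) + \sum_(j < i.+1) 'C(j.+1, m))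
    + ((m == 0) * (s + 3) + (m == 1))
  = 'C(s.+2, m) + 'C(s.+2, m.+1) + 'C(s.+2, m.+2).
Proof.
elim: s => [|s IH]; first by rewrite big_ord0; case: m => [|[|[|m]]].
have inner : \sum_(j < s.+1) 'C(j.+1, m) + (m == 0) = 'C(s.+2, m.+1).
  by rewrite -bin_hockey [RHS]big_ord_recl addnC; case: m {IH}.
rewrite big_ord_recr /= !(binS s.+2) -inner.
case: m IH inner => [|m] /=; rewrite ?bin0 ?(binS s.+2); lia.
Qed.

Lemma momentS (k m : nat) :
  moment k.+1 m + ((m == 0) * (moment k 1 + 3 * moment k 0) + (m == 1) * moment k 0) =
  \sum_(w <- words k) ('C((descent_prefix w).+2, m) + 'C((descent_prefix w).+2, m.+1)
                       + 'C((descent_prefix w).+2, m.+2)).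
Proof.
rewrite -(eq_bigr _ (fun w _ => sum_children (descent_prefix w) m)).
rewrite [RHS]big_split /= {1}/moment (sum_words k (binomial^~ m)); congr (_ + _).
rewrite /moment !(big_distrr, =^~ big_split) /=.
by apply: eq_bigr => w _; rewrite bin1 bin0; lia.
Qed.

(** For [m = 0] and [m = 1] the correction in [momentS] survives, so these two orders have
    recurrences of their own. *)
Lemma moment0S (k : nat) : moment k.+1 0 = moment k 0 + 2 * moment k 1 + moment k 2.
Proof.
have := momentS k 0; set S := \sum_(_ <- _) _.
have -> : S = 4 * moment k 0 + 3 * moment k 1 + moment k 2; last by lia.
rewrite /moment !(big_distrr, =^~ big_split) /=.
by apply: eq_bigr => w _; rewrite !(binS, bin0); lia.
Qed.

Lemma moment1S (k : nat) :
  moment k.+1 1 = 2 * moment k 0 + 4 * moment k 1 + 3 * moment k 2 + moment k 3.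
Proof.
have := momentS k 1; set S := \sum_(_ <- _) _.
have -> : S = 3 * moment k 0 + 4 * moment k 1 + 3 * moment k 2 + moment k 3; last by lia.
rewrite /moment !(big_distrr, =^~ big_split) /=.
by apply: eq_bigr => w _; rewrite !(binS, bin0); lia.
Qed.

(** [moment k m] is the coefficient of [z^k v^m] in [F(z, 1 + v)]. Pascal's rule produces the
    coefficients 1, 3, 4, 3, 1 of the kernel polynomial [(1 + v)^2 (1 + v + v^2)]. *)
Lemma momentSS (k m : nat) :
  moment k.+1 m.+2 = moment k m + 3 * moment k m.+1 + 4 * moment k m.+2
                     + 3 * moment k m.+3 + moment k m.+4.
Proof.
have := momentS k m.+2; set S := \sum_(_ <- _) _.
have -> : S = moment k m + 3 * moment k m.+1 + 4 * moment k m.+2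
                     + 3 * moment k m.+3 + moment k m.+4; last by lia.
rewrite /moment !(big_distrr, =^~ big_split) /=.
by apply: eq_bigr => w _; rewrite !binS; lia.
Qed.

Lemma moment_empty (m : nat) : moment 0 m = (m == 0).
Proof. by rewrite /moment big_seq1; case: m. Qed.

(** * The bijection between words and ordered partitions *)

Definition blocks_of_word (k : nat) (w : seq nat) : k.-tuple {set 'I_(2 * k)} :=
  [tuple [set x : 'I_(2 * k) | nth 0 w x == i] | i < k].

Lemma mem_blocks_of_word (k : nat) (w : seq nat) (i : 'I_k) (x : 'I_(2 * k)) :
  (x \in tnth (blocks_of_word k w) i) = (nth 0 w x == i).
Proof. by rewrite tnth_mktuple inE. Qed.

Lemma card_blocks_of_word (k : nat) (w : seq nat) (i : 'I_k) :
  size w = 2 * k -> #|tnth (blocks_of_word k w) i| = count_mem (i : nat) w.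
Proof.
move=> sw; rewrite tnth_mktuple cardsE -sum1_card -sum1_count.
by rewrite (big_nth 0) big_mkord sw.
Qed.

(** Elements are positions and block indices are letters, so on both sides the pattern consists of
    three places where position and letter increase together. *)
Lemma contains123_blocks_of_word (k : nat) (w : seq nat) :
  size w = 2 * k -> all (gtn k) w ->
  contains123 (blocks_of_word k w) = ~~ avoids123 w.
Proof.
move=> sw lt; apply/idP/idP.
  move=> /existsP[i1 /existsP[i2 /existsP[i3 /andP[i123]]]].
  move=> /existsP[b1 /andP[B1 /existsP[b2 /andP[B2 /existsP[b3 /andP[B3 b123]]]]]].
  move: B1 B2 B3; rewrite !mem_blocks_of_word => /eqP B1 /eqP B2 /eqP B3.
  apply/avoids123P => /(_ b1 b2 b3); rewrite B1 B2 B3 i123 sw ltn_ord.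
  by case/andP: b123 => -> -> /(_ isT isT isT).
apply: contraR => nc; apply/avoids123P => x y z xy yz zw.
apply: contra nc => wxyz; rewrite sw in zw.
have yw := ltn_trans yz zw; have xw := ltn_trans xy yw.
have nk n : n < 2 * k -> nth 0 w n < k.
  by rewrite -sw => nw; apply: (allP lt); rewrite mem_nth.
apply/existsP; exists (Ordinal (nk _ xw)); apply/existsP; exists (Ordinal (nk _ yw)).
apply/existsP; exists (Ordinal (nk _ zw)); rewrite wxyz /=.
apply/existsP; exists (Ordinal xw); rewrite mem_blocks_of_word eqxx /=.
apply/existsP; exists (Ordinal yw); rewrite mem_blocks_of_word eqxx /=.
by apply/existsP; exists (Ordinal zw); rewrite mem_blocks_of_word eqxx /= xy yz.
Qed.

Lemma blocks_of_word_partition (k : nat) (w : seq nat) :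
  double_word k w -> ordered_partition (blocks_of_word k w).
Proof.
move=> [sw lt ct _]; apply/and3P; split.
- apply/forallP => i; rewrite -card_gt0 card_blocks_of_word // ct //.
- apply/forallP => i; apply/forallP => j; apply/implyP => ij.
  rewrite disjoint_subset; apply/subsetP => x.
  rewrite inE !mem_blocks_of_word => /eqP ->.
  by apply: contra ij => /eqP ij; apply/eqP/val_inj.
- apply/eqP/setP => x; rewrite inE; apply/bigcupP.
  have nk : nth 0 w x < k by apply: (allP lt); rewrite mem_nth // sw.
  by exists (Ordinal nk) => //; rewrite mem_blocks_of_word.
Qed.

Lemma partition_word_exists (k : nat) (B : k.-tuple {set 'I_(2 * k)}) :
  ordered_partition B ->
  exists w, [/\ size w = 2 * k, all (gtn k) w & blocks_of_word k w = B].
Proof.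
move=> /and3P[_ /forallP dB /eqP cB].
(* The default 0 is never reached, since the blocks cover the ground set. *)
pose blk (x : 'I_(2 * k)) : nat :=
  if [pick i | x \in tnth B i] is Some i then nat_of_ord i else 0.
have blkP x (i : 'I_k) : (x \in tnth B i) = (blk x == i).
  rewrite /blk; case: pickP => [j xj|no]; last first.
    have := in_setT x; rewrite -cB => /bigcupP[j _]; by rewrite no.
  apply/idP/eqP => [xi|/val_inj <- //].
  congr nat_of_ord; apply/eqP; apply: contraT => ji.
  have /forallP /(_ i) /implyP /(_ ji) := dB j.
  by rewrite disjoint_subset => /subsetP /(_ x xj); rewrite inE xi.
exists [seq blk x | x <- enum 'I_(2 * k)].
have nthw (x : 'I_(2 * k)) : nth 0 [seq blk y | y <- enum 'I_(2 * k)] x = blk x.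
  by rewrite (nth_map x) ?size_enum_ord // nth_ord_enum.
split; first by rewrite size_map size_enum_ord.
- apply/allP => _ /mapP[x _ ->] /=.
  have := in_setT x; rewrite -cB => /bigcupP[j _].
  by rewrite blkP => /eqP ->.
- by apply: eq_from_tnth => i; apply/setP => x; rewrite mem_blocks_of_word nthw blkP.
Qed.

(** The zeroth moment counts words because ['C(s, 0) = 1], and [blocks_of_word] is a bijection from
    [words k] onto the partitions counted by [op2_123 k]. *)
Lemma op2_123_moment (k : nat) : op2_123 k = moment k 0.
Proof.
have -> : moment k 0 = size [seq blocks_of_word k w | w <- words k].
  rewrite size_map -sum1_size /moment; apply: eq_bigr => w _; exact: bin0.
have inj : {in words k &, injective (blocks_of_word k)}.
  move=> w w' /mem_words[sw lt _ _] /mem_words[sw' _ _ _] E.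
  apply: (@eq_from_nth _ 0) => [|n nw]; first by rewrite sw.
  have nk : nth 0 w n < k by apply: (allP lt); rewrite mem_nth.
  rewrite sw in nw; have := mem_blocks_of_word w (Ordinal nk) (Ordinal nw).
  by rewrite E mem_blocks_of_word /= eqxx => /eqP.
have /card_uniqP <- : uniq [seq blocks_of_word k w | w <- words k].
  by rewrite map_inj_in_uniq ?words_uniq.
apply: eq_card => B; rewrite inE; apply/and3P/mapP.
- move=> [oB /forallP cB nc]; have [w [sw lt BE]] := partition_word_exists oB.
  exists w => //; apply/mem_words; split=> // [c ck|].
    by rewrite -(card_blocks_of_word (Ordinal ck) sw) BE; apply/eqP/cB.
  by move: nc; rewrite -BE contains123_blocks_of_word // negbK.
- move=> [w /mem_words wk ->]; have [sw lt ct av] := wk.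
  rewrite blocks_of_word_partition // contains123_blocks_of_word // negbK av.
  by split=> //; apply/forallP => i; rewrite card_blocks_of_word // ct.
Qed.

(** * The ring of formal power series *)

Local Open Scope ring_scope.

(** Equality of infinite coefficient sequences is made boolean by classical axioms, as the ring
    structure requires. *)
HB.instance Definition _ (R : nzRingType) := gen_eqMixin (fps R).
HB.instance Definition _ (R : nzRingType) := gen_choiceMixin (fps R).

Section FpsRing.
Variable R : comNzRingType.
Implicit Types s t u : fps R.

Definition fps_opp s : fps R := fun n => - s n.
Definition fps1 : fps R := fun n => (n == 0%N)%:R.

Lemma fpsP s t : s =1 t <-> s = t.
Proof. by split=> [/funext|->]. Qed.

Let addA : associative (@fps_add R).
Proof. by move=> s t u; apply/fpsP => n; apply: addrA. Qed.
Let addC : commutative (@fps_add R).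
Proof. by move=> s t; apply/fpsP => n; apply: addrC. Qed.
Let add0 : left_id (@fps0 R) (@fps_add R).
Proof. by move=> s; apply/fpsP => n; apply: add0r. Qed.
Let addN : left_inverse (@fps0 R) fps_opp (@fps_add R).
Proof. by move=> s; apply/fpsP => n; apply: addNr. Qed.

HB.instance Definition _ := GRing.isZmodule.Build (fps R) addA addC add0 addN.

(** A coefficient of a product depends only on truncations of the factors, so the ring laws descend
    from polynomials. The second factor only has to agree with [p] below [N], which lets it be a
    product itself when associativity is proved. *)
Lemma fps_mul_truncr (N n : nat) s (p : {poly R}) t : (n < N)%N ->
  (forall i, (i < N)%N -> t i = p`_i) ->
  fps_mul s t n = (\poly_(i < N) s i * p)`_n.
Proof.
move=> nN tp; rewrite coefM; apply: eq_bigr => i _; rewrite !coef_poly.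
rewrite (leq_trans _ nN) ?ltn_ord // tp //.
by rewrite (leq_ltn_trans (leq_subr _ _) nN).
Qed.

Lemma fps_mul_poly (N n : nat) s t : (n < N)%N ->
  fps_mul s t n = (\poly_(i < N) s i * \poly_(i < N) t i)`_n.
Proof. by move=> nN; apply: fps_mul_truncr => // i iN; rewrite coef_poly iN. Qed.

Let mulC : commutative (@fps_mul R).
Proof. by move=> s t; apply/fpsP => n; rewrite !(fps_mul_poly _ _ (ltnSn n)) mulrC. Qed.
Let mulA : associative (@fps_mul R).
Proof.
move=> s t u; apply/fpsP => n.
have H s' t' u' : fps_mul s' (fps_mul t' u') n =
    (\poly_(i < n.+1) s' i * (\poly_(i < n.+1) t' i * \poly_(i < n.+1) u' i))`_n.
  by apply: fps_mul_truncr => // i iN; apply: fps_mul_poly.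
by rewrite (mulC (fps_mul s t)) !H mulrA mulrC.
Qed.
Let mul1 : left_id fps1 (@fps_mul R).
Proof.
move=> s; apply/fpsP => n; rewrite /fps_mul big_ord_recl /= /fps1 mul1r subn0.
by rewrite big1 ?addr0 // => i _; rewrite mul0r.
Qed.
Let mulDl : left_distributive (@fps_mul R) (@fps_add R).
Proof.
move=> s t u; apply/fpsP => n; rewrite /fps_mul /fps_add -big_split /=.
by apply: eq_bigr => i _; rewrite mulrDl.
Qed.
Let one_neq0 : fps1 != 0.
Proof.
apply/eqP => /fpsP /(_ 0%N); rewrite /fps1 eqxx.
by move/eqP; rewrite oner_eq0.
Qed.

HB.instance Definition _ :=
  GRing.Zmodule_isComNzRing.Build (fps R) mulA mulC mul1 mulDl one_neq0.

Lemma coef_fpsD s t n : (s + t)%R n = s n + t n. Proof. by []. Qed.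
Lemma coef_fpsN s n : (- s)%R n = - s n. Proof. by []. Qed.
Lemma coef_fpsM s t n : (s * t)%R n = \sum_(i < n.+1) s i * t (n - i)%N.
Proof. by []. Qed.
Lemma coef_fps1 n : (1%R : fps R) n = (n == 0%N)%:R. Proof. by []. Qed.
Lemma coef_fpsMn s m n : (s *+ m)%R n = s n *+ m.
Proof. by elim: m => [//|m IH]; rewrite !mulrS coef_fpsD IH. Qed.
Lemma coef_fps_natM (m : nat) s n : (m%:R * s)%R n = m%:R * s n.
Proof. by rewrite !mulr_natl coef_fpsMn. Qed.

Definition fpsX : fps R := fun n => (n == 1%N)%:R.

Lemma coef_fpsXM s n : (fpsX * s) n = if n is n'.+1 then s n' else 0.
Proof.
rewrite coef_fpsM big_ord_recl mul0r add0r; case: n => [|n]; first by rewrite big_ord0.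
rewrite big_ord_recl /= mul1r subSS subn0 big1 ?addr0 // => i _.
by rewrite mul0r.
Qed.

(** The Euler operator [z d/dz]: a derivation that fixes [z] and multiplies the coefficient of index
    [n] by [n]. *)
Definition fps_euler s : fps R := fun n => s n *+ n.
Arguments fps_euler s%_R.

Lemma fps_eulerD s t : fps_euler (s + t) = fps_euler s + fps_euler t.
Proof. by apply/fpsP => n; rewrite /fps_euler !coef_fpsD mulrnDl. Qed.
Lemma fps_eulerN s : fps_euler (- s) = - fps_euler s.
Proof. by apply/fpsP => n; rewrite /fps_euler !coef_fpsN mulNrn. Qed.
Lemma fps_eulerM s t : fps_euler (s * t) = fps_euler s * t + s * fps_euler t.
Proof.
apply/fpsP => n; rewrite coef_fpsD !coef_fpsM /fps_euler /fps_mul -sumrMnl.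
rewrite -big_split /=; apply: eq_bigr => i _.
by rewrite mulrnAl mulrnAr -mulrnDr subnKC // -ltnS.
Qed.
Lemma fps_euler_nat m : fps_euler m%:R = 0.
Proof.
apply/fpsP => -[|n]; rewrite /fps_euler ?mulr0n //.
by rewrite coef_fpsMn coef_fps1 mul0rn mul0rn.
Qed.
Lemma fps_eulerX : fps_euler fpsX = fpsX.
Proof. by apply/fpsP => -[|[|n]]; rewrite /fps_euler /fpsX /= ?mulr1n ?mul0rn. Qed.

(** * Fixed points, inverses and the kernel root *)

Definition fps_agree n s t := forall i, (i < n)%N -> s i = t i.
Arguments fps_agree n s%_R t%_R.

Lemma fps_agreeD n s s' t t' :
  fps_agree n s s' -> fps_agree n t t' -> fps_agree n (s + t) (s' + t').
Proof. by move=> H K i ni; rewrite !coef_fpsD H ?K. Qed.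
Lemma fps_agreeN n s s' : fps_agree n s s' -> fps_agree n (- s) (- s').
Proof. by move=> H i ni; rewrite !coef_fpsN H. Qed.
Lemma fps_agreeM n s s' t t' :
  fps_agree n s s' -> fps_agree n t t' -> fps_agree n (s * t) (s' * t').
Proof.
move=> H K i ni; rewrite !coef_fpsM; apply: eq_bigr => j _.
rewrite H ?K //; first exact: leq_ltn_trans (leq_subr _ _) ni.
exact: leq_trans (ltn_ord j) ni.
Qed.
Lemma fps_agreeX n s s' : fps_agree n s s' -> fps_agree n.+1 (fpsX * s) (fpsX * s').
Proof. by move=> H [|i] ni; rewrite !coef_fpsXM // H. Qed.

(** The operator gains one correct coefficient per application, so its iterates from 0 stabilize
    coefficientwise. *)
Lemma fps_fixpoint (f : fps R -> fps R) :
  (forall n s t, fps_agree n s t -> fps_agree n.+1 (f s) (f t)) ->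
  exists s, f s = s.
Proof.
move=> fc; pose a n := iter n f 0.
have step n : fps_agree n (a n) (a n.+1).
  by elim: n => [//|n IH]; rewrite /a !(iterS n); apply/fc: IH.
have stab n m i : (i < n)%N -> a (n + m)%N i = a n i.
  move=> ni; elim: m => [|m IH]; first by rewrite addn0.
  by rewrite addnS -step ?IH // (leq_trans ni) // leq_addr.
(* Coefficient [n] no longer changes from iterate [n + 1] on, so the diagonal is the limit. *)
exists (fun n => a n.+1 n); apply/fpsP => n.
have -> : a n.+1 n = f (a n) n by [].
apply: (fc n) => // i ni.
by rewrite -(stab i.+1 (n - i.+1)%N) // subnKC.
Qed.

(** The geometric series, obtained as the fixed point of [s = 1 + z t s]. *)
Lemma fps_inv_exists t : exists s, (1 - fpsX * t) * s = 1.
Proof.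
have [|s sE] := @fps_fixpoint (fun s => 1 + fpsX * (t * s)).
  move=> n s s' H; apply: fps_agreeD => //; apply: fps_agreeX.
  exact: fps_agreeM.
exists s; have -> : (1 - fpsX * t) * s = s - fpsX * (t * s) by ring.
by rewrite -{1}sE addrK.
Qed.
End FpsRing.

Lemma fps_lreg (R : comNzRingType) (t : fps R) : GRing.lreg (1 - fpsX R * t).
Proof.
have [s sE] := fps_inv_exists t.
apply: (can_inj (g := *%R s)) => x.
by rewrite mulrA (mulrC s) sE mul1r.
Qed.

(** Putting [q = z r] and cancelling [z] leaves [r (1 - q)^2 = (1 + q + q^2)^2]. Expanded and solved
    for [r], every term other than 1 carries a factor [z], so the equation is a contracting
    fixed-point equation. *)
Lemma kernel_root_exists (R : comNzRingType) : exists r : fps R,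
  let q := fpsX R * r in q * (1 - q) ^+ 2 = fpsX R * (1 + q + q ^+ 2) ^+ 2.
Proof.
pose z := fpsX R.
have [|r rE] := @fps_fixpoint R (fun r => 1 + z * (2 * r + 3 * (z * (r * r))
  + 2 * (z * (z * (r * (r * r)))) + z * (z * (z * (r * (r * (r * r)))))
  + 2 * (r * r) - z * (r * (r * r)))).
  move=> n s t st; apply: fps_agreeD => //; apply: fps_agreeX.
  by do ?[apply: fps_agreeD | apply: fps_agreeN | apply: fps_agreeM].
exists r; rewrite /= -/z; set q := z * r.
have -> : q * (1 - q) ^+ 2 = q - 2 * q ^+ 2 + q ^+ 3 by ring.
rewrite {1}/q -{1}rE /q; ring.
Qed.

(** * The parametrization by [q] *)

Section Parametrization.
Variables (R : comNzRingType) (z q t A : R).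
(** Fractions are replaced by cancellable denominators: [t] stands for [3 q / (1 - q)], the sum of
    the two small kernel roots, and [A] for [F(z, 1)]. The factor [1 - 5 q + q^2] enters through the
    derivative of [z] with respect to [q]. *)
Hypothesis qE : q * (1 - q) ^+ 2 = z * (1 + q + q ^+ 2) ^+ 2.
Hypothesis subq_lreg : GRing.lreg (1 - q).
Hypothesis addq_lreg : GRing.lreg (1 + q).
Hypothesis W_lreg : GRing.lreg (1 + q + q ^+ 2).
Hypothesis K_lreg : GRing.lreg (1 - 5 * q + q ^+ 2).
Hypothesis tE : (1 - q) * t = 3 * q.
Hypothesis AE : (1 - q) * (1 + q) * A = 1 + q + q ^+ 2.

(** The roots of [X^2 - t X - q] are the two small kernel roots, so it divides
    [z (1 + X)^2 (1 + X + X^2) - X^2]. Hence a solution of the two-term recurrence satisfies the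
    kernel recurrence. *)
Lemma kernel_recurrence (x y : R) :
  let x2 := t * y + q * x in
  let x3 := t * x2 + q * y in
  let x4 := t * x3 + q * x2 in
  x2 = z * (x + 3 * y + 4 * x2 + 3 * x3 + x4).
Proof.
move=> x2 x3 x4.
(* The denominator of [z] is [(1 + q + q^2)^2], and its numerator contains [(1 - q)^2]; one more
   factor [1 - q] clears the cube below [x4]. *)
apply: W_lreg; apply: W_lreg; apply: subq_lreg.
have -> : (1 - q) * ((1 + q + q ^+ 2) * ((1 + q + q ^+ 2) *
    (z * (x + 3 * y + 4 * x2 + 3 * x3 + x4)))) =
   (z * (1 + q + q ^+ 2) ^+ 2) * ((1 - q) * (x + 3 * y + 4 * x2 + 3 * x3 + x4)) by ring.
rewrite -qE.
have e2 : (1 - q) * x2 = 3 * q * y + (1 - q) * q * x.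
  by rewrite -tE /x2; ring.
have e3 : (1 - q) ^+ 2 * x3 =
    3 * q * (3 * q * y + (1 - q) * q * x) + (1 - q) ^+ 2 * q * y.
  by rewrite -e2 -tE /x3; ring.
have e4 : (1 - q) ^+ 3 * x4 =
    3 * q * (3 * q * (3 * q * y + (1 - q) * q * x) + (1 - q) ^+ 2 * q * y)
   + (1 - q) ^+ 2 * q * (3 * q * y + (1 - q) * q * x).
  by rewrite -e3 -e2 -tE /x4; ring.
transitivity ((1 + q + q ^+ 2) ^+ 2 * ((1 - q) * x2)); first by ring.
transitivity (q * ((1 - q) ^+ 3 * (x + 3 * y) + 4 * (1 - q) ^+ 2 * ((1 - q) * x2)
   + 3 * (1 - q) * ((1 - q) ^+ 2 * x3) + (1 - q) ^+ 3 * x4)); last by ring.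
by rewrite e4 e3 e2; ring.
Qed.

(** The moment equation for [m = 0]: the values [1], [t - q], [t (t - q) + q] are the first
    coefficients of [(1 - q v) / (1 - t v - q v^2)], and the summand 1 is the empty word. *)
Lemma kernel_init0 :
  A = 1 + z * A * (1 + 2 * (t - q) + (t * (t - q) + q)).
Proof.
apply: W_lreg; apply: W_lreg; apply: subq_lreg; apply: addq_lreg.
transitivity ((1 + q + q ^+ 2) ^+ 2 * ((1 - q) * (1 + q) * A)); first by ring.
rewrite AE.
transitivity ((1 + q + q ^+ 2) ^+ 2 * ((1 - q) * (1 + q)) + (z * (1 + q + q ^+ 2) ^+ 2)
  * ((1 - q) * (1 + q) * A) * (1 + 2 * (t - q) + (t * (t - q) + q))); last by ring.
rewrite AE -qE.
transitivity ((1 + q + q ^+ 2) ^+ 2 * ((1 - q) * (1 + q)) + q * (1 + q + q ^+ 2) *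
  ((1 - q) ^+ 2 * (1 - q) + 2 * (1 - q) * ((1 - q) * t)
   + ((1 - q) * t) * ((1 - q) * t - (1 - q) * q)));
  last by ring.
by rewrite tE; ring.
Qed.

(** The moment equation for [m = 1], with the common factor [A] divided out. *)
Lemma kernel_init1 :
  let x2 := t * (t - q) + q in
  let x3 := t * x2 + q * (t - q) in
  t - q = z * (2 + 4 * (t - q) + 3 * x2 + x3).
Proof.
move=> x2 x3.
apply: W_lreg; apply: W_lreg; apply: subq_lreg.
have e2 : (1 - q) ^+ 2 * x2 = 3 * q * (3 * q - (1 - q) * q) + (1 - q) ^+ 2 * q.
  by rewrite -tE /x2; ring.
have e3 : (1 - q) ^+ 3 * x3 = 3 * q * (3 * q * (3 * q - (1 - q) * q) + (1 - q) ^+ 2 * q)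
   + (1 - q) ^+ 2 * q * (3 * q - (1 - q) * q).
  by rewrite -e2 -tE /x3; ring.
transitivity ((1 + q + q ^+ 2) ^+ 2 * ((1 - q) * t - (1 - q) * q)); first by ring.
transitivity (z * (1 + q + q ^+ 2) ^+ 2 * (1 - q) * (2 + 4 * (t - q) + 3 * x2 + x3));
  last by ring.
rewrite -qE.
transitivity (q * (2 * (1 - q) ^+ 3 + 4 * (1 - q) ^+ 2 * ((1 - q) * t - (1 - q) * q)
   + 3 * (1 - q) * ((1 - q) ^+ 2 * x2) + (1 - q) ^+ 3 * x3)); last by ring.
by rewrite e3 e2 tE; ring.
Qed.

(** * Euler derivatives of [A] as rational functions of [q] *)

Variable T : R -> R.
Hypothesis TD : {morph T : x y / x + y}.
Hypothesis TN : {morph T : x / - x}.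
Hypothesis TM : forall x y, T (x * y) = T x * y + x * T y.
Hypothesis Tn : forall n : nat, T n%:R = 0.
Hypothesis Tz : T z = z.
Let T1 : T 1 = 0. Proof. exact: (Tn 1). Qed.

(** Numerator of [T (T A)] over the denominator [(1 - q) (1 + q)^5 (1 - 5 q + q^2)^3]. *)
Definition euler2_numerator :=
  q * (1 + q + q ^+ 2) * (1 + 8 * q - 5 * q ^+ 2 - 14 * q ^+ 3
  - 88 * q ^+ 4 - 14 * q ^+ 5 - 5 * q ^+ 6 + 8 * q ^+ 7 + q ^+ 8).

Definition euler3_numerator :=
  q * (1 + q + q ^+ 2) * (1 + 24 * q + 41 * q ^+ 2 + 76 * q ^+ 3
  - 696 * q ^+ 4 + 536 * q ^+ 5 - 330 * q ^+ 6 + 2640 * q ^+ 7 - 330 * q ^+ 8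
  + 536 * q ^+ 9 - 696 * q ^+ 10 + 76 * q ^+ 11 + 41 * q ^+ 12 + 24 * q ^+ 13
  + q ^+ 14).

(** Differentiate the kernel equation with [T z = z]. The factor of [T q] is [1 - 4 q - 4 q^2 + q^3
    = (1 + q) (1 - 5 q + q^2)]. *)
Lemma euler_q :
  (1 + q) * (1 - 5 * q + q ^+ 2) * T q = q * (1 - q) * (1 + q + q ^+ 2).
Proof.
have := congr1 T qE; rewrite !expr2 !(TM, TD, TN) Tz T1.
move=> H; apply: subq_lreg.
transitivity ((T q * ((1 - q) * (1 - q)) + q * ((0 - T q) * (1 - q) + (1 - q) * (0 - T q)))
   * (1 + q + q ^+ 2) - 2 * (q * (1 - q) ^+ 2) * (1 + 2 * q) * T q).
  by ring.
rewrite H qE.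
transitivity ((z * (1 + q + q ^+ 2) ^+ 2) * (1 + q + q ^+ 2)); first by ring.
by rewrite -qE; ring.
Qed.

Lemma euler_A :
  (1 - q) * (1 + q) ^+ 3 * (1 - 5 * q + q ^+ 2) * T A =
  q * (1 + q + q ^+ 2) * (1 + 4 * q + q ^+ 2).
Proof.
have := congr1 T AE; rewrite !expr2 !(TM, TD, TN) T1 => H.
apply: subq_lreg.
transitivity ((1 - q) * (1 + q) * ((1 + q) * (1 - 5 * q + q ^+ 2)) *
  ((((0 - T q) * (1 + q) + (1 - q) * (0 + T q)) * A + (1 - q) * (1 + q) * T A))
  + 2 * q * ((1 - q) * (1 + q) * A) * ((1 + q) * (1 - 5 * q + q ^+ 2) * T q)).
  by ring.
rewrite H AE.
transitivity (((1 - q) * (1 + q) * (1 + 2 * q) + 2 * q * (1 + q + q ^+ 2))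
  * ((1 + q) * (1 - 5 * q + q ^+ 2) * T q)); first by ring.
by rewrite euler_q; ring.
Qed.

Lemma euler_exp (x : R) (n : nat) : T (x ^+ n.+1) = n.+1%:R * x ^+ n * T x.
Proof.
elim: n => [|n IH]; first by rewrite expr1 expr0 mulr1 mul1r.
by rewrite exprS TM IH (exprS x n) -[n.+2]addn1 natrD; ring.
Qed.

Let TE := (euler_exp, T1, Tn, TM, TD, TN).

(** The quotient rule for [f = N / D], where [D'] and [N'] are derivatives with respect to [q] and
    [T q] is eliminated by [euler_q]. *)
Lemma euler_quotient (D N D' N' f : R) :
  D * f = N -> T D = D' * T q -> T N = N' * T q ->
  D ^+ 2 * ((1 + q) * (1 - 5 * q + q ^+ 2)) * T f =
  (N' * D - N * D') * (q * (1 - q) * (1 + q + q ^+ 2)).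
Proof.
move=> fE DE NE; have := congr1 T fE; rewrite TM DE NE -euler_q -fE => H.
transitivity (D * ((1 + q) * (1 - 5 * q + q ^+ 2)) * (D' * T q * f + D * T f)
  - D * ((1 + q) * (1 - 5 * q + q ^+ 2)) * (D' * T q * f)); first by ring.
by rewrite H; ring.
Qed.

Lemma euler2_A :
  (1 - q) * (1 + q) ^+ 5 * (1 - 5 * q + q ^+ 2) ^+ 3 * T (T A) = euler2_numerator.
Proof.
have D : T ((1 - q) * (1 + q) ^+ 3 * (1 - 5 * q + q ^+ 2)) =
  (- ((1 + q) ^+ 3 * (1 - 5 * q + q ^+ 2))
    + (1 - q) * (3 * (1 + q) ^+ 2 * (1 - 5 * q + q ^+ 2)
    + (1 + q) ^+ 3 * (1 * 1 * (2 * q - 5)))) * T q.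
  by rewrite !TE; ring.
have N : T (q * (1 + q + q ^+ 2) * (1 + 4 * q + q ^+ 2)) =
  ((1 + q + q ^+ 2) * (1 + 4 * q + q ^+ 2) + q * ((1 + 2 * q) * (1 + 4 * q + q ^+ 2)
    + (1 + q + q ^+ 2) * (4 + 2 * q))) * T q.
  by rewrite !TE; ring.
have H := euler_quotient euler_A D N.
(* The quotient rule squares the old denominator; the surplus factor [(1 - q) (1 + q)^2] cancels
   against the numerator. *)
apply: subq_lreg; do 2!apply: addq_lreg.
transitivity (((1 - q) * (1 + q) ^+ 3 * (1 - 5 * q + q ^+ 2)) ^+ 2
  * ((1 + q) * (1 - 5 * q + q ^+ 2)) * T (T A)).
  by ring.
by rewrite H /euler2_numerator; ring.
Qed.

Lemma euler3_A :
  (1 - q) * (1 + q) ^+ 7 * (1 - 5 * q + q ^+ 2) ^+ 5 * T (T (T A)) = euler3_numerator.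
Proof.
have D : T ((1 - q) * (1 + q) ^+ 5 * (1 - 5 * q + q ^+ 2) ^+ 3) =
  (- ((1 + q) ^+ 5 * (1 - 5 * q + q ^+ 2) ^+ 3)
    + (1 - q) * (5 * (1 + q) ^+ 4 * (1 - 5 * q + q ^+ 2) ^+ 3
    + (1 + q) ^+ 5 * (3 * (1 - 5 * q + q ^+ 2) ^+ 2 * (2 * q - 5)))) * T q.
  by rewrite !TE; ring.
pose S := 1 + 8 * q - 5 * q ^+ 2 - 14 * q ^+ 3
  - 88 * q ^+ 4 - 14 * q ^+ 5 - 5 * q ^+ 6 + 8 * q ^+ 7 + q ^+ 8.
have N : T euler2_numerator =
  ((1 + q + q ^+ 2) * S + q * ((1 + 2 * q) * S
    + (1 + q + q ^+ 2) * (8 - 10 * q - 42 * q ^+ 2 - 352 * q ^+ 3 - 70 * q ^+ 4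
      - 30 * q ^+ 5 + 56 * q ^+ 6 + 8 * q ^+ 7))) * T q.
  by rewrite /S /euler2_numerator !TE; ring.
have H := euler_quotient euler2_A D N.
(* Here the surplus factor is [(1 - q) (1 + q)^4 (1 - 5 q + q^2)^2]. *)
apply: subq_lreg; do 4!apply: addq_lreg; do 2!apply: K_lreg.
transitivity (((1 - q) * (1 + q) ^+ 5 * (1 - 5 * q + q ^+ 2) ^+ 3) ^+ 2
  * ((1 + q) * (1 - 5 * q + q ^+ 2)) * T (T (T A))).
  by ring.
by rewrite H /S /euler2_numerator /euler3_numerator; ring.
Qed.

(** This is the differential equation of the theorem for [z = x^2], where [x d/dx] becomes [2 T].
    The denominator of the third derivative is common to all terms, and [(1 + q + q^2)^4] clears
    that of [z^2]; a polynomial identity in [q] remains. *)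
Lemma euler_ode :
  - 28 * T (T (T A)) + 22 * T (T A) + 18 * T A
  + z * (329 * T (T (T A)) + 228 * T (T A) - 17 * T A - 12 * A)
  + z * (z * (84 * T (T (T A)) + 270 * T (T A) + 258 * T A + 72 * A)) = 0.
Proof.
set Z := LHS.
pose D := (1 - q) * (1 + q) ^+ 7 * (1 - 5 * q + q ^+ 2) ^+ 5.
have e0 : D * A = (1 + q) ^+ 6 * (1 - 5 * q + q ^+ 2) ^+ 5 * (1 + q + q ^+ 2).
  by rewrite -AE /D; ring.
have e1 : D * T A = (1 + q) ^+ 4 * (1 - 5 * q + q ^+ 2) ^+ 4 *
    (q * (1 + q + q ^+ 2) * (1 + 4 * q + q ^+ 2)).
  by rewrite -euler_A /D; ring.
have e2 : D * T (T A) = (1 + q) ^+ 2 * (1 - 5 * q + q ^+ 2) ^+ 2 * euler2_numerator.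
  by rewrite -euler2_A /D; ring.
have e3 : D * T (T (T A)) = euler3_numerator by exact: euler3_A.
have DZ : (1 + q + q ^+ 2) ^+ 4 * (D * Z) = 0.
  transitivity ((1 + q + q ^+ 2) ^+ 4 *
      (- 28 * (D * T (T (T A))) + 22 * (D * T (T A)) + 18 * (D * T A))
    + z * (1 + q + q ^+ 2) ^+ 2 * (1 + q + q ^+ 2) ^+ 2 *
      (329 * (D * T (T (T A))) + 228 * (D * T (T A)) - 17 * (D * T A) - 12 * (D * A))
    + (z * (1 + q + q ^+ 2) ^+ 2) ^+ 2 *
      (84 * (D * T (T (T A))) + 270 * (D * T (T A)) + 258 * (D * T A) + 72 * (D * A))).
    by rewrite /Z; ring.
  by rewrite -qE e0 e1 e2 e3 /euler2_numerator /euler3_numerator; ring.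
apply: subq_lreg; do 7!apply: addq_lreg; do 5!apply: K_lreg; do 4!apply: W_lreg.
by rewrite !mulr0 -DZ /D; ring.
Qed.
End Parametrization.

(** * The counting sequence *)

Lemma moment_series (R : comNzRingType) : exists A : fps R,
  (forall k, A k = (moment k 0)%:R) /\
  let T := @fps_euler R in let z := fpsX R in
  - 28 * T (T (T A)) + 22 * T (T A) + 18 * T A
  + z * (329 * T (T (T A)) + 228 * T (T A) - 17 * T A - 12 * A)
  + z * (z * (84 * T (T (T A)) + 270 * T (T A) + 258 * T A + 72 * A)) = 0.
Proof.
have [r qE] := kernel_root_exists R; move: qE => /=.
set z := fpsX R; set q := z * r => qE.
have [i1 i1E] := fps_inv_exists r.
have [i2 i2E] := fps_inv_exists (- r).
(* Each denominator has constant term 1, hence the form [1 - z s] that [fps_lreg] makes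
   cancellable. *)
have subq : GRing.lreg (1 - q) by exact: fps_lreg.
have addq : GRing.lreg (1 + q).
  by rewrite (_ : 1 + q = 1 - z * - r); [exact: fps_lreg | rewrite /q; ring].
have W : GRing.lreg (1 + q + q ^+ 2).
  rewrite (_ : _ + _ = 1 - z * (- r - z * r ^+ 2)); first exact: fps_lreg.
  by rewrite /q; ring.
have K : GRing.lreg (1 - 5 * q + q ^+ 2).
  rewrite (_ : _ + _ = 1 - z * (5 * r - z * r ^+ 2)); first exact: fps_lreg.
  by rewrite /q; ring.
have i1q : (1 - q) * i1 = 1 by [].
have i2q : (1 + q) * i2 = 1 by rewrite -[RHS]i2E -/z /q; ring.
pose t := 3 * q * i1.
have tE : (1 - q) * t = 3 * q.
  by transitivity (3 * q * ((1 - q) * i1)); [rewrite /t; ring | rewrite i1q mulr1].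
pose A := (1 + q + q ^+ 2) * i1 * i2.
have AE : (1 - q) * (1 + q) * A = 1 + q + q ^+ 2.
  transitivity ((1 + q + q ^+ 2) * ((1 - q) * i1) * ((1 + q) * i2)).
    by rewrite /A; ring.
  by rewrite i1q i2q !mulr1.
exists A; split; last first.
  apply: (@euler_ode _ z q A qE subq addq W K AE).
  - exact: fps_eulerD.
  - exact: fps_eulerN.
  - exact: fps_eulerM.
  - exact: fps_euler_nat.
  - exact: fps_eulerX.
(* [c m] is the coefficient of [v^m] in [(1 - q v) / (1 - t v - q v^2)]. *)
pose c := fix c m := match m with 0 => 1 | 1 => t - q
  | (m1.+1 as m2).+1 => t * c m2 + q * c m1 end.
have cSS m : c m.+2 = t * c m.+1 + q * c m by [].
have B0 : A * c 0 = 1 + z * (A * c 0 + 2 * (A * c 1) + A * c 2).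
  rewrite cSS /= {1}mulr1 {1}(kernel_init0 qE subq addq W tE AE) mulr1; ring.
have B1 : A * c 1 = z * (2 * (A * c 0) + 4 * (A * c 1) + 3 * (A * c 2) + A * c 3).
  rewrite !cSS {1}/c (kernel_init1 qE subq W tE) /= mulr1; ring.
have B2 m : A * c m.+2 = z * (A * c m + 3 * (A * c m.+1) + 4 * (A * c m.+2)
    + 3 * (A * c m.+3) + A * c m.+4).
  rewrite {1}cSS (kernel_recurrence qE subq W tE (c m) (c m.+1)) -!cSS; ring.
(* All moments are treated at once, since a step in [k] uses orders up to two higher. *)
suff H k m : (A * c m) k = (moment k m)%:R by move=> k; rewrite -H /= mulr1.
elim: k m => [|k IH] [|[|m]].
- by rewrite B0 coef_fpsD coef_fpsXM moment_empty addr0.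
- by rewrite B1 coef_fpsXM moment_empty.
- by rewrite B2 coef_fpsXM moment_empty.
- rewrite B0 coef_fpsD coef_fpsXM coef_fps1 add0r.
  by rewrite !coef_fpsD !coef_fps_natM !IH moment0S !(natrM, natrD).
- rewrite B1 coef_fpsXM !coef_fpsD !coef_fps_natM !IH moment1S.
  by rewrite !(natrM, natrD).
- rewrite B2 coef_fpsXM !coef_fpsD !coef_fps_natM !IH momentSS.
  by rewrite !(natrM, natrD).
Qed.

(** Coefficients of [z] and of [z^(k+2)] in the equation of [moment_series], where each Euler
    operator becomes a factor equal to the index. *)
Lemma op2_123_recurrence (R : comNzRingType) (a : nat -> R) :
  (forall k, a k = (op2_123 k)%:R) ->
  12 * a 1%N - 12 * a 0%N = 0 /\
  forall k,
  (- 28 * k.+2%:R ^+ 3 + 22 * k.+2%:R ^+ 2 + 18 * k.+2%:R) * a k.+2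
  + (329 * k.+1%:R ^+ 3 + 228 * k.+1%:R ^+ 2 - 17 * k.+1%:R - 12) * a k.+1
  + (84 * k%:R ^+ 3 + 270 * k%:R ^+ 2 + 258 * k%:R + 72) * a k = 0.
Proof.
move=> aE; have [A [Aa ode]] := moment_series R.
have {}Aa k : A k = a k by rewrite Aa aE op2_123_moment.
have coef k := congr1 (fun s : fps R => s k) ode.
split=> [|k].
  have := coef 1%N; rewrite mulNr.
  rewrite !(coef_fpsD, coef_fpsN, coef_fpsXM, coef_fps_natM) /fps_euler !Aa => H.
  by apply: etrans H; rewrite !mulr1n !mulr0n; ring.
have := coef k.+2; rewrite mulNr.
rewrite !(coef_fpsD, coef_fpsN, coef_fpsXM, coef_fps_natM) /fps_euler !Aa => H.
apply: etrans H.
rewrite -!(mulr_natr (a _)) -!(mulr_natr (_ * _)).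
ring.
Qed.

(** * Coefficients of the terms of the differential equation *)

Lemma coef_monomial_mul (R : comNzRingType) (c : R) (d : nat) (s : fps R) (n : nat) :
  (fps_poly (c *: 'X^d) * s)%fps n = if (d <= n)%N then c * s (n - d)%N else 0.
Proof.
rewrite /fps_mul /fps_poly; case: leqP => dn.
  rewrite (bigD1 (Ordinal (dn : (d < n.+1)%N))) //= coefZ coefXn eqxx mulr1.
  rewrite big1 ?addr0 // => i ni; rewrite coefZ coefXn.
  by rewrite (_ : (i == d :> nat) = false) ?mulr0 ?mul0r //; apply/negbTE.
apply: big1 => i _; rewrite coefZ coefXn.
by rewrite (_ : (i == d :> nat) = false) ?mulr0 ?mul0r //; have := ltn_ord i; lia.
Qed.

Lemma coef_derivn (R : nzRingType) (s : fps R) (j n : nat) :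
  (s^`(j))%fps n = s (n + j)%N *+ (n + j) ^_ j.
Proof.
elim: j n => [|j IH] n; first by rewrite addn0 ffactn0 mulr1n.
by rewrite iterS /fps_deriv IH -addSnnS -mulrnA ffactnSr addnK.
Qed.

(** Multiplication shifts by [e + j] and differentiation shifts back by [j], leaving a net shift of
    [e]. For [e <= n < e + j] the falling factorial vanishes, so the condition [e <= n] suffices. *)
Lemma coef_monomial_derivn (R : comNzRingType) (c : R) (e j : nat) (s : fps R)
    (n : nat) :
  (fps_poly (c *: 'X^(e + j)) * s^`(j))%fps n =
  c * ((if (e <= n)%N then s (n - e)%N else 0) * ((n - e) ^_ j)%:R).
Proof.
rewrite coef_monomial_mul mulr_natr coef_derivn; case: leqP => ejn.
  have en : (e <= n)%N by exact: leq_trans (leq_addr _ _) ejn.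
  by rewrite en subnDA subnK // leq_subRL.
case: leqP => en; last by rewrite mul0rn mulr0.
by rewrite ffact_small ?mulr0n ?mulr0 //; lia.
Qed.

(** The falling factorial is polynomial in [n]: once truncated subtraction differs from subtraction
    in [R], the preceding product is already 0. *)
Lemma natr_ffact (R : comNzRingType) (n j : nat) :
  (n ^_ j)%:R = \prod_(i < j) (n%:R - i%:R) :> R.
Proof.
elim: j => [|j IH]; first by rewrite ffactn0 big_ord0.
rewrite ffactnSr natrM IH big_ord_recr /=; case: (leqP j n) => jn.
  by rewrite natrB.
by rewrite -IH ffact_small // !mul0r.
Qed.

Lemma coef_polyD_mul (R : comNzRingType) (p p' : {poly R}) (s : fps R) (n : nat) :
  (fps_poly (p + p') * s)%fps n = (fps_poly p * s)%fps n + (fps_poly p' * s)%fps n.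
Proof.
by rewrite /fps_mul -big_split; apply: eq_bigr => i _; rewrite /fps_poly coefD mulrDl.
Qed.

Theorem theorem3p2 :
  ( ((21 / 2) *: 'X^7 + (329 / 8) *: 'X^5 - (7 / 2) *: 'X^3)%:S * Q^`(3)
  + (99 *: 'X^6 + (1443 / 8) *: 'X^4 - 5 *: 'X^2)%:S * Q^`(2)
  + (207 *: 'X^5 + (717 / 8) *: 'X^3 + 11 *: 'X)%:S * Q^`(1)
  + (72 *: 'X^4 - 12 *: 'X^2)%:S * Q)%fps =1 fps0.
Proof.
move=> n; pose a k : rat := (op2_123 k)%:R.
have [//|rec1 rec] := @op2_123_recurrence _ a.
have ff2 m : (m ^_ 2)%:R = m%:R * (m%:R - 1) :> rat.
  by rewrite natr_ffact !big_ord_recr big_ord0 /=; ring.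
have ff3 m : (m ^_ 3)%:R = m%:R * (m%:R - 1) * (m%:R - 2) :> rat.
  by rewrite natr_ffact !big_ord_recr big_ord0 /=; ring.
have QE k : Q k.*2 = a k by rewrite /Q odd_double doubleK.
have Q_odd k : odd k -> Q k = 0 by rewrite /Q => ->.
rewrite /fps_add -(expr1 'X) -!scaleNr !coef_polyD_mul.
(* Each degree is split as [e + j], with [j] the order of the derivative. Then [e] is 0, 2 or 4, and
   only the coefficients of [Q] at [n], [n - 2] and [n - 4] occur. *)
rewrite (coef_monomial_derivn _ 4 3) (coef_monomial_derivn _ 2 3).
rewrite (coef_monomial_derivn _ 0 3) (coef_monomial_derivn _ 4 2).
rewrite (coef_monomial_derivn _ 2 2) (coef_monomial_derivn _ 0 2).
rewrite (coef_monomial_derivn _ 4 1) (coef_monomial_derivn _ 2 1).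
rewrite (coef_monomial_derivn _ 0 1) (coef_monomial_derivn _ 4 0).
rewrite (coef_monomial_derivn _ 2 0) !ffactn0 !ffactn1 !ff2 !ff3.
rewrite leq0n subn0 /fps0; clearbody a.
(* For odd [n] all these indices are odd and every term vanishes. *)
have [n_odd|n_even] := boolP (odd n).
  have Q0 e : ~~ odd e -> (if (e <= n)%N then Q (n - e)%N else 0) = 0.
    by move=> oe; case: leqP => // en; rewrite Q_odd // oddB // n_odd (negPf oe).
  by rewrite !Q0 // Q_odd //; ring.
(* For [n = 0] the remaining falling factorials vanish, for [n = 2] the initial relation [rec1]
   applies, and from [n = 4] on the recurrence does. *)
rewrite -(even_halfK n_even); case: (n./2) => [|[|k]].
- rewrite (QE 0%N) (_ : (4 <= 0.*2)%N = false) // (_ : (2 <= 0.*2)%N = false) //.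
  by rewrite double0; ring.
- rewrite (QE 1%N) (_ : (4 <= 1.*2)%N = false) // (_ : (2 <= 1.*2)%N) //.
  by rewrite (_ : 1.*2 - 2 = 0.*2)%N // QE -[RHS]rec1 -!muln2 !natrM; field.
- rewrite QE (_ : (4 <= k.+2.*2)%N) // (_ : (2 <= k.+2.*2)%N) //.
  rewrite (_ : k.+2.*2 - 2 = k.+1.*2)%N; last by lia.
  rewrite (_ : k.+2.*2 - 4 = k.*2)%N; last by lia.
  by rewrite !QE -[RHS](rec k) -!muln2 !natrM; field.
Qed.
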